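(* Let $(\lambda_n)_{n\in\mathbb N}$ and $(\widetilde\lambda_n)_{n\in\mathbb N}$ be two sequences of positive real numbers with $\sum_n\lambda_n<\infty$ and $\sum_n\widetilde\lambda_n<\infty$, with counting functions $\mathcal N(\lambda)$ and $\widetilde{\mathcal N}(\lambda)$ ($\lambda>0$), respectively. Suppose that $\mathcal N$ satisfies $$\liminf_{x\to0+}\frac{\int_0^{hx}\mathcal N(\lambda)\,d\lambda}{\int_0^{x}\mathcal N(\lambda)\,d\lambda}>1\qquad\text{for any } h>1.$$ If $\mathcal N(\lambda)\sim\widetilde{\mathcal N}(\lambda)$ as $\lambda\to0+$, then, as $r\to0+$, $$\ln\mathbf P\Big\{\sum_{n=1}^\infty\widetilde\lambda_n\xi_n^2\le r\Big\}\sim\ln\mathbf P\Big\{\sum_{n=1}^\infty\lambda_n\xi_n^2\le r\Big\}.$$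
   Context: Here $\xi_n$, $n\in\mathbb N$, are independent standard normal random variables. The counting function of a positive summable sequence $(\lambda_n)$ is $\mathcal N(\lambda)=\#\{n:\lambda_n>\lambda\}$ for $\lambda>0$, and similarly $\widetilde{\mathcal N}(\lambda)=\#\{n:\widetilde\lambda_n>\lambda\}$. The notation $f\sim g$ means that the ratio $f/g$ tends to $1$ in the indicated limit. *)

(* Defs.v *)
From HB Require Import structures.
From mathcomp Require Import all_boot all_order all_algebra.
From mathcomp Require Import finmap.
From mathcomp Require Import all_classical all_reals all_analysis.

Set Implicit Arguments.
Unset Strict Implicit.
Unset Printing Implicit Defensive.

Import Order.TTheory GRing.Theory Num.Theory.
Import numFieldNormedType.Exports.

Local Open Scope classical_set_scope.
Local Open Scope ring_scope.

(* The set is finite when [x > 0] and [lam] is summable; the junk value of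
   [fset_set] (the empty set) can only occur for [x <= 0]. *)
Definition counting_function (R : realType) (lam : nat -> R) (x : R) : R :=
  #|` fset_set [set n | lam n > x]|%:R.

Definition counting_primitive (R : realType) (lam : nat -> R) (x : R) : R :=
  \int[lebesgue_measure]_(y in `]0, x]) counting_function lam y.

(* [f ~ g] along [F] as convergence of the ratio, rather than the little-o
   formulation of [landau]. *)
Definition ratio_equiv (R : realType) (F : set_system R) (f g : R -> R) : Prop :=
  f x / g x @[x --> F] --> (1 : R).

Definition mutually_independent (R : realType) (d : measure_display)
    (T : measurableType d) (P : probability T R) (X : nat -> {RV P >-> R}) : Prop :=
  forall (J : {fset nat}) (B : nat -> set R),
    (forall n, n \in J -> measurable (B n)) ->
    P (\bigcap_(n in [set` J]) (X n @^-1` B n)) =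
    (\prod_(n <- J) P (X n @^-1` B n))%E.

(* [normal_prob] takes the standard deviation as second parameter. The laws are
   compared on Borel sets only: elsewhere neither side is meaningful. *)
Definition standard_normal (R : realType) (d : measure_display)
    (T : measurableType d) (P : probability T R) (X : {RV P >-> R}) : Prop :=
  forall B : set R, measurable B -> distribution P X B = normal_prob 0 1 B.

(* The series is taken in [\bar R], so that it equals [+oo] where it diverges. *)
Definition small_ball_probability (R : realType) (d : measure_display)
    (T : measurableType d) (P : probability T R) (X : nat -> {RV P >-> R})
    (lam : nat -> R) (r : R) : R :=
  fine (P [set w | (\sum_(0 <= n <oo) (lam n * X n w ^+ 2)%:E <= r%:E)%E]).

(* Main.v *)
Require Import Defs.
From HB Require Import structures.
From mathcomp Require Import all_boot all_order all_algebra.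
From mathcomp Require Import finmap.
From mathcomp Require Import all_classical all_reals all_analysis.
From mathcomp Require Import measurable_realfun.
From mathcomp Require Import ring lra.

Set Implicit Arguments.
Unset Strict Implicit.
Unset Printing Implicit Defensive.

Import Order.TTheory GRing.Theory Num.Theory.
Import numFieldNormedType.Exports.

Local Open Scope classical_set_scope.
Local Open Scope ring_scope.

(* Write [F u = 1/2 sum_k ln (1 + 2 u lam_k)], so that [E exp (- u S) = exp (- F u)]
   for [S = sum_k lam_k xi_k^2], and [D = F']. Chernoff's bound gives
   [- ln P (S <= r) >= F u - u r] for every [u]. Under the law tilted by
   [exp (- u S)] the sum concentrates around [s = D u] (two more Chernoff bounds,
   using only that [F] is concave and that [u D u] increases to infinity), whence
   [- ln P (S <= (1 + eta) s) <= F u - u s + eta u s + 1].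
   The counting functions enter through the layer-cake formula
   [sum_k g (lam_k) = int N d g]: it shows that [F] and [F~] are equivalent at
   infinity and that the primitive of [N] at [x] is [sum_k min (lam_k, x)]. The
   liminf condition, for [h = 2] only, yields [u D u <= C (F u - u D u)], i.e.
   the errors [eta u s] and [F~ u - F u] are negligible with respect to
   [F u - u s]. The condition passes from [N] to [N~], so that the two
   probabilities play symmetric roles. *)

(** * Layer-cake formula and independence *)

Lemma measurable_set_pred d (T : measurableType d) (p : T -> bool) :
  measurable_fun setT p -> measurable [set x | p x].
Proof.
by move=> /(_ measurableT [set true] I); rewrite setTI.
Qed.

(** Tonelli on the region under the graph of [h]: [h w] is the length of []0, h w[]. The weight [Y]
    leaves room for a density or for the other factors of a product. *)
Lemma integral_layer d (T : measurableType d) (R : realType)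
    (mu : {sigma_finite_measure set T -> \bar R}) (Y h : T -> R) :
  measurable_fun setT Y -> measurable_fun setT h ->
  (forall w, 0 <= Y w) -> (forall w, 0 <= h w) ->
  (\int[mu]_w (Y w * h w)%:E =
   \int[lebesgue_measure]_t
     \int[mu]_w (Y w * \1_[set x | (0 < t < x)%R] (h w))%:E)%E.
Proof.
move=> mY mh Y0 h0.
pose A := [set z : T * R | 0 < z.2 < h z.1].
have mA : measurable A.
  have -> : A = [set z : T * R | 0 < z.2] `&` [set z : T * R | z.2 < h z.1].
    by apply/seteqP; split=> z; rewrite /A /= => /andP.
  apply: measurableI; apply: measurable_set_pred; apply: measurable_fun_ltr => //.
  exact: measurableT_comp mh measurable_fst.
pose f z := (Y z.1 * \1_A z)%:E.
transitivity (\int[mu]_w \int[lebesgue_measure]_t f (w, t))%E; last first.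
  rewrite fubini_tonelli//.
  - apply/measurable_EFinP/measurable_funM.
      exact: measurableT_comp mY measurable_fst.
    exact: measurable_indic.
  - by move=> z; rewrite lee_fin mulr_ge0.
apply: eq_integral => w _; rewrite /f /=.
under eq_integral do rewrite EFinM.
have eqA t : \1_A (w, t) = \1_(`]0, h w[%classic : set R) t :> R.
  by rewrite !indicE; congr (_%:R); congr nat_of_bool; apply/idP/idP;
     rewrite !inE /A /= in_itv.
under eq_integral do rewrite eqA.
rewrite ge0_integralZl_EFin//; last first.
  by apply/measurable_EFinP; exact: measurable_indic.
rewrite integral_indic//= setIT lebesgue_measure_itv /= lte_fin.
have [_|hw] := ltP 0 (h w); first by rewrite oppr0 adde0 EFinM.
by rewrite (le_anti (introT andP (conj hw (h0 w)))) mulr0 mule0.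
Qed.

(* Both sides depend on [h] only through the measures of its super-level sets. *)
Lemma eq_integral_of_indic d1 d2 (T1 : measurableType d1)
    (T2 : measurableType d2) (R : realType)
    (mu1 : {sigma_finite_measure set T1 -> \bar R})
    (mu2 : {sigma_finite_measure set T2 -> \bar R})
    (Y1 X1 : T1 -> R) (Y2 X2 : T2 -> R) (h : R -> R) :
  measurable_fun setT Y1 -> measurable_fun setT X1 ->
  measurable_fun setT Y2 -> measurable_fun setT X2 ->
  (forall w, 0 <= Y1 w) -> (forall w, 0 <= Y2 w) ->
  (forall B, measurable B -> \int[mu1]_w (Y1 w * \1_B (X1 w))%:E =
    \int[mu2]_w (Y2 w * \1_B (X2 w))%:E)%E ->
  measurable_fun setT h -> (forall x, 0 <= h x) ->
  (\int[mu1]_w (Y1 w * h (X1 w))%:E = \int[mu2]_w (Y2 w * h (X2 w))%:E)%E.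
Proof.
move=> mY1 mX1 mY2 mX2 Y10 Y20 E mh h0.
rewrite (integral_layer mu1 mY1 (measurableT_comp mh mX1) Y10 (fun w => h0 _)).
rewrite (integral_layer mu2 mY2 (measurableT_comp mh mX2) Y20 (fun w => h0 _)).
apply: eq_integral => t _.
have mB : measurable [set x : R | 0 < t < h x].
  have [t0|t0] := ltP 0 t; last first.
    by rewrite (_ : [set _ | _] = set0)//; apply/seteqP; split.
  by apply: measurable_set_pred; exact: measurable_fun_ltr.
exact: E _ mB.
Qed.

(** Independence concerns events, that is, products of indicators. The indicators are replaced by
    general functions one factor at a time. *)
Lemma expectation_prod (R : realType) d (T : measurableType d)
    (P : probability T R) (X : nat -> {RV P >-> R}) (n : nat)
    (g : nat -> R -> R) :
  mutually_independent X ->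
  (forall k, measurable_fun setT (g k)) -> (forall k x, 0 <= g k x <= 1) ->
  (\int[P]_w (\prod_(k < n) g k (X k w))%:E =
   \prod_(k < n) \int[P]_w (g k (X k w))%:E)%E.
Proof.
move=> indep mg g01.
(* Induction on [m]: the first [m] factors are arbitrary, those from index [m] on are indicators.
   The case [m = 0] is independence itself. *)
suff: forall m (g : nat -> R -> R), (m <= n)%N ->
    (forall k, measurable_fun setT (g k)) -> (forall k x, 0 <= g k x <= 1) ->
    (forall k, (m <= k)%N -> exists2 B, measurable B & g k = \1_B) ->
    (\int[P]_w (\prod_(k < n) g k (X k w))%:E =
     \prod_(k < n) \int[P]_w (g k (X k w))%:E)%E.
  (* Beyond [n] the factors are reset to an indicator, as the condition on indices from [m = n] on
     demands. *)
  pose g' k : R -> R := if (k < n)%N then g k else \1_setT.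
  move=> /(_ n g' (leqnn _)).
  have gg' (k : 'I_n) : g' k = g k by rewrite /g' ltn_ord.
  under [in X in (_ -> _ -> _ -> X = _) -> _]eq_integral do
    under eq_bigr do rewrite gg'.
  under [in X in (_ -> _ -> _ -> _ = X) -> _]eq_bigr do rewrite gg'.
  apply.
  - by move=> k; rewrite /g'; case: ifP => _//; exact: measurable_indic.
  - move=> k x; rewrite /g'; case: ifP => _//.
    by rewrite indicE; case: (_ \in _); rewrite ?ler01 ?lexx.
  - by move=> k nk; exists setT => //; rewrite /g' ltnNge nk.
elim=> [|m IH] {mg g01}g mn mg g01 gB.
  have /choice[B HB] : forall k, exists B, measurable B /\ g k = \1_B.
    by move=> k; have [B mB ->] := gB k (leq0n k); exists B.
  have mB k : measurable (B k) by case: (HB k).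
  have eB k : g k = \1_(B k) by case: (HB k).
  pose J := [fset k | k in iota 0 n]%fset.
  have JE k : (k \in J) = (k < n)%N.
    by rewrite in_fset /= mem_iota leq0n add0n.
  have := indep J B (fun k _ => mB k).
  have -> : (\prod_(k <- J) P (X k @^-1` B k) =
      \prod_(k < n) \int[P]_w (g k (X k w))%:E)%E.
    rewrite -(big_mkord xpredT (fun k => \int[P]_w (g k (X k w))%:E)%E).
    rewrite (perm_big (index_iota 0 n)); last first.
      apply: uniq_perm; rewrite ?fset_uniq ?iota_uniq// => k.
      by rewrite mem_index_iota leq0n JE.
    apply: eq_bigr => k _.
    rewrite -[X in P X]setIT -integral_indic//; last exact: measurable_funPTI.
    by apply: eq_integral => w _; rewrite eB.
  move=> <-.
  rewrite -[X in P X]setIT -integral_indic//; last first.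
    apply: bigcap_measurableType => k _; exact: measurable_funPTI.
  apply: eq_integral => w _; congr EFin.
  rewrite indicE; case: (boolP (w \in _)) => [/set_mem/= wI|].
    rewrite big1// => k _; rewrite eB indicE mem_set//.
    by apply: wI; rewrite /= JE ltn_ord.
  rewrite notin_setE => wI.
  have [k kn Hk] : exists2 k, (k < n)%N & ~ B k (X k w).
    apply: contrapT => /forall2NP H; apply: wI => k /=; rewrite JE => kn.
    by have [//|/contrapT] := H k.
  by rewrite (bigD1 (Ordinal kn))//= eB indicE memNset// mul0r.
(* Once factor [m] is isolated, both sides integrate it, against the weight [Y] on the left and the
   constant [c] on the right. It suffices that they agree when this factor is an indicator, which is
   the induction hypothesis. *)
pose m' := Ordinal mn.
pose Y w := \prod_(k < n | k != m') g k (X k w).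
pose c := (\prod_(k < n | k != m') \int[P]_w (g k (X k w))%:E)%E.
have gfin k : (\int[P]_w (g k (X k w))%:E \is a fin_num)%E.
  rewrite ge0_fin_numE; last first.
    by apply: integral_ge0 => w _; rewrite lee_fin; case/andP: (g01 k (X k w)).
  apply: (@le_lt_trans _ _ (\int[P]_w (cst 1%E w))%E).
    apply: ge0_le_integral => //.
    - by move=> w _; rewrite lee_fin; case/andP: (g01 k (X k w)).
    - exact/measurable_EFinP/measurableT_comp.
    - by move=> w _; rewrite lee_fin; case/andP: (g01 k (X k w)).
  by rewrite integral_cst// mul1e (le_lt_trans (probability_le1 _ _))// ltry.
have cfin : c \is a fin_num by apply: prode_fin_num => k _.
have c0 : 0 <= fine c.
  apply: fine_ge0; apply: prode_ge0 => k _.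
  by apply: integral_ge0 => w _; rewrite lee_fin; case/andP: (g01 k (X k w)).
have mY : measurable_fun setT Y.
  apply: (eq_measurable_fun (fun w => \prod_(k < n) if k != m' then g k (X k w) else 1)).
    by move=> w _; rewrite /Y [RHS]big_mkcond.
  apply: measurable_prod => k _.
  by case: (k != m') => //; exact: measurableT_comp.
have Y0 w : 0 <= Y w by apply: prodr_ge0 => k _; case/andP: (g01 k (X k w)).
transitivity (\int[P]_w (Y w * g m (X m w))%:E)%E.
  by apply: eq_integral => w _; rewrite (bigD1 m')//= mulrC.
transitivity (\int[P]_w (fine c * g m (X m w))%:E)%E; last first.
  under eq_integral do rewrite EFinM.
  rewrite ge0_integralZl_EFin//.
  - by rewrite fineK// muleC (bigD1 m').
  - by move=> w _; rewrite lee_fin; case/andP: (g01 m (X m w)).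
  - exact/measurable_EFinP/measurableT_comp.
apply: (@eq_integral_of_indic _ _ _ _ _ P P Y (X m) (cst (fine c)) (X m)) => //.
- move=> B mB.
  pose gB' k := if k == m then \1_B else g k.
  have gm (k : 'I_n) : k != m' -> gB' k = g k.
    by rewrite /gB' -val_eqE /= => /negbTE ->.
  have := IH gB' (ltnW mn).
  have -> : (\int[P]_w (\prod_(k < n) gB' k (X k w))%:E =
      \int[P]_w (Y w * \1_B (X m w))%:E)%E.
    apply: eq_integral => w _; rewrite (bigD1 m')//= {1}/gB' eqxx mulrC.
    by congr (_ * _)%:E; apply: eq_bigr => k km; rewrite gm.
  have -> : (\prod_(k < n) \int[P]_w (gB' k (X k w))%:E =
      \int[P]_w (cst (fine c) w * \1_B (X m w))%:E)%E.
    under [RHS]eq_integral do rewrite EFinM.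
    rewrite ge0_integralZl_EFin//.
    - rewrite fineK// muleC (bigD1 m')//= {1}/gB' eqxx.
      by congr (_ * _)%E; apply: eq_bigr => k km; rewrite gm.
    - exact/measurable_EFinP/measurableT_comp.
  apply.
  - by move=> k; rewrite /gB'; case: ifP => _//; exact: measurable_indic.
  - move=> k x; rewrite /gB'; case: ifP => _//.
    by rewrite indicE; case: (_ \in _); rewrite ?ler01 ?lexx.
  - move=> k; rewrite leq_eqVlt => /orP[/eqP<-|mk].
      by exists B => //; rewrite /gB' eqxx.
    by rewrite /gB' gtn_eqF//; exact: gB.
- by move=> x; case/andP: (g01 m x).
Qed.

(** The standard normal density times [expR (- c * x ^+ 2)] is [s] times the centred normal density
    of standard deviation [s = (1 + 2 * c)^(-1/2)]. *)
Lemma expectation_expR_normal (R : realType) d (T : measurableType d)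
    (P : probability T R) (X : {RV P >-> R}) (c : R) :
  standard_normal X -> 0 <= c ->
  (\int[P]_w (expR (- c * X w ^+ 2))%:E = (expR (- (ln (1 + 2 * c) / 2)))%:E)%E.
Proof.
move=> XN c0.
have mh : measurable_fun setT (fun x : R => expR (- c * x ^+ 2)).
  apply: measurableT_comp => //; apply: measurable_funM => //.
(* Change of variables: weight 1 under [P] against the normal density under Lebesgue measure. *)
have := @eq_integral_of_indic _ _ _ _ _ P (@lebesgue_measure R)
  (cst 1) X (normal_pdf 0 1) id (fun x => expR (- c * x ^+ 2)).
under eq_integral do rewrite mul1r.
move=> -> //; last first.
- move=> B mB.
  have := XN B mB; rewrite /distribution /pushforward /normal_prob => H.
  transitivity (P (X @^-1` B)).
    rewrite -[X in P X]setIT -integral_indic//; last exact: measurable_funPTI.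
    by apply: eq_integral => w _; rewrite mul1r.
  rewrite H integral_mkcond; apply: eq_integral => x _.
  by rewrite patchE indicE; case: (x \in B); rewrite ?mulr1 ?mulr0.
- by move=> x; exact: normal_pdf_ge0.
- exact: measurable_normal_pdf.
have c1 : 0 < 1 + 2 * c by lra.
set s := expR (- (ln (1 + 2 * c) / 2)).
have s0 : 0 < s by exact: expR_gt0.
have s2 : s ^+ 2 = (1 + 2 * c)^-1.
  rewrite -expRM_natl /= -[RHS]lnK ?posrE ?invr_gt0// lnV ?posrE//.
  by congr expR; field.
transitivity (\int[lebesgue_measure]_x (s%:E * (normal_pdf 0 s x)%:E))%E.
  apply: eq_integral => x _; rewrite -EFinM; congr EFin.
  rewrite !normal_pdfE ?gt_eqF// /normal_peak /normal_fun -mulrA -expRD subr0.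
  rewrite expr1n mul1r [RHS]mulrA s2.
  congr (_ * expR _).
    rewrite -mulrnAr sqrtrM ?invr_ge0 ?(ltW c1)// -s2 sqrtr_sqr gtr0_norm// invfM.
    by rewrite mulrA divff ?mul1r// gt_eqF.
  rewrite -[(1 + 2 * c)^-1 *+ 2]mulr_natl invfM invrK -[1 *+ 2]/(2%:R).
  by field.
rewrite ge0_integralZl_EFin ?(ltW s0)//.
- by rewrite integral_normal_pdf mule1.
- by move=> x _; rewrite lee_fin normal_pdf_ge0.
- by apply/measurable_EFinP; exact: measurable_normal_pdf.
Qed.

(** * Series and counting functions *)

Lemma nneseries_lim (R : realType) (a : nat -> R) : cvgn (series a) ->
  (\sum_(0 <= n <oo) (a n)%:E = (limn (series a))%:E)%E.
Proof.
move=> ca; rewrite -EFin_lim//; congr (limn _).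
by apply/funext => n; rewrite /= seriesEnat sumEFin.
Qed.

Lemma finite_set_gt (R : realType) (a : nat -> R) (x : R) :
  cvgn (series a) -> 0 < x -> finite_set [set n | x < a n].
Proof.
move=> /cvg_series_cvg_0/cvgr_lt/(_ _) => /[apply] -[N _ aN].
apply: (sub_finite_set _ (finite_II N)) => n /= xa; rewrite ltnNge.
by apply/negP => /aN /=; rewrite ltNge (ltW xa).
Qed.

(** The series form gives measurability in [x] and termwise integration. *)
Lemma counting_functionE (R : realType) (a : nat -> R) (x : R) :
  cvgn (series a) -> 0 < x ->
  ((counting_function a x)%:E = \sum_(0 <= n <oo) (x < a n)%R%:R%:E)%E.
Proof.
move=> ca x0; have fin := finite_set_gt ca x0.
transitivity (\sum_(n <oo | (x < a n)%R) (1 : \bar R))%E; last first.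
  rewrite eseries_mkcond; apply: eq_eseriesr => n _.
  by case: (_ < _).
rewrite nneseries_esum// esum_fset// fsbig_finite//=.
by rewrite sumEFin /counting_function -sum1_size natr_sum.
Qed.

Lemma counting_function_ge0 (R : realType) (a : nat -> R) (x : R) :
  0 <= counting_function a x.
Proof. exact: ler0n. Qed.

Lemma eq_counting_function (R : realType) (a b : nat -> R) (x y : R) :
  (forall n, (x < a n) = (y < b n)) ->
  counting_function a x = counting_function b y.
Proof.
by move=> ab; congr (#|` fset_set _|%:R); apply/seteqP; split=> n /=; rewrite ab.
Qed.

Lemma measurable_counting_function (R : realType) (a : nat -> R) :
  cvgn (series a) ->
  measurable_fun (`]0, +oo[ : set R) (fun x : R => (counting_function a x)%:E).
Proof.
move=> ca.
apply: (eq_measurable_fun (fun x : R => \sum_(0 <= n <oo) (x < a n)%R%:R%:E)%E).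
  by move=> x; rewrite inE /= in_itv /= andbT => x0; rewrite counting_functionE.
apply: ge0_emeasurable_sum => // n _.
apply: measurable_funTS.
apply: (eq_measurable_fun (fun x : R => (\1_(`]-oo, a n[%classic : set R) x)%:E)).
  move=> x _; rewrite indicE; congr (_%:R%:E); congr nat_of_bool.
  by apply/idP/idP; rewrite inE /= in_itv.
by apply/measurable_EFinP; exact: measurable_indic.
Qed.

(** Each [a n] is the length of []0, a n[]; nonnegativity allows the sum and the integral to be
    exchanged. *)
Lemma series_layer (R : realType) (a : nat -> R) :
  (forall n, 0 <= a n) -> cvgn (series a) ->
  ((limn (series a))%:E =
   \int[lebesgue_measure]_(x in `]0%R, +oo[) (counting_function a x)%:E)%E.
Proof.
move=> a0 ca; rewrite -nneseries_lim//.
transitivity (\int[lebesgue_measure]_(x in `]0%R, +oo[)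
    (\sum_(0 <= n <oo) (\1_(`]-oo, a n[%classic : set R) x)%:E))%E; last first.
  apply: eq_integral => x; rewrite inE /= in_itv /= andbT => x0.
  rewrite counting_functionE//; apply: eq_eseriesr => n _.
  rewrite indicE; congr (_%:R%:E); congr nat_of_bool.
  by apply/idP/idP; rewrite inE /= in_itv.
rewrite integral_nneseries//; last first.
  by move=> n; apply/measurable_EFinP; exact: measurable_indic.
apply: eq_eseriesr => n _.
rewrite integral_indic//= setIC -(set_itv_splitI `]0%R, a n[).
rewrite lebesgue_measure_itv /= lte_fin.
have [_|an] := ltP 0 (a n); first by rewrite oppr0 adde0.
by rewrite (le_anti (introT andP (conj an (a0 n)))).
Qed.

(** Integrates the pointwise bound through [series_layer]; every comparison of series below goes
    through this lemma. *)
Lemma le_series_of_counting (R : realType) (a b : nat -> R) (c : R) :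
  (forall n, 0 <= a n) -> (forall n, 0 <= b n) ->
  cvgn (series a) -> cvgn (series b) -> 0 <= c ->
  (forall x, 0 < x -> counting_function a x <= c * counting_function b x) ->
  limn (series a) <= c * limn (series b).
Proof.
move=> a0 b0 ca cb c0 ab; rewrite -lee_fin EFinM !series_layer//.
rewrite -ge0_integralZl_EFin//; last 2 first.
- by move=> x _; rewrite lee_fin counting_function_ge0.
- exact: measurable_counting_function.
apply: ge0_le_integral => //.
- by move=> x _; rewrite lee_fin counting_function_ge0.
- exact: measurable_counting_function.
- apply: emeasurable_funM => //; exact: measurable_counting_function.
- by move=> x; rewrite /= in_itv /= andbT => x0; rewrite -EFinM lee_fin ab.
Qed.

Lemma is_cvg_series_min (R : realType) (lam : nat -> R) (x : R) :
  (forall k, 0 < lam k) -> cvgn (series lam) -> 0 < x ->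
  cvgn (series (fun k => Num.min (lam k) x)).
Proof.
move=> lam0 clam x0; apply: series_le_cvg clam => k.
- by rewrite le_min !ltW.
- exact: ltW.
- by rewrite ge_min lexx.
Qed.

(** Truncating the terms at [x] leaves the counting function unchanged below [x] and makes it vanish
    from [x] on. *)
Lemma counting_primitiveE (R : realType) (a : nat -> R) (x : R) :
  (forall n, 0 < a n) -> cvgn (series a) -> 0 < x ->
  counting_primitive a x = limn (series (fun n => Num.min (a n) x)).
Proof.
move=> a0 ca x0.
have cmin := is_cvg_series_min a0 ca x0.
rewrite /counting_primitive /Rintegral -[RHS]/(fine (limn _)%:E).
rewrite series_layer//; last by move=> n; rewrite le_min !ltW.
congr fine; rewrite -integral_itv_bndo_bndc; last first.
  apply: measurable_funS (measurable_counting_function ca) => //.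
  by apply: subset_itvl; rewrite bnd_simp.
rewrite integral_mkcond [RHS]integral_mkcond; apply: eq_integral => y _.
rewrite !patchE; have [y0|y0] := ltP 0 y; last first.
  by rewrite !memNset//= in_itv /= ltNge y0.
rewrite [in RHS]mem_set /= ?in_itv /= ?y0//.
have [yx|xy] := ltP y x.
  rewrite mem_set /= ?in_itv /= ?y0//; congr EFin.
  by apply: eq_counting_function => n; rewrite lt_min yx andbT.
rewrite memNset /= ?in_itv /= ?y0 /= ?ltNge ?xy//.
rewrite /counting_function (_ : [set n | _] = set0) ?fset_set0 ?cardfs0//.
by apply/seteqP; split=> n //=; rewrite lt_min ltNge andbC ltNge xy.
Qed.

(** * Exponential bounds for small ball probabilities *)

Definition log_laplace (R : realType) (lam : nat -> R) (u : R) : R :=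
  limn (series (fun k => ln (1 + 2 * (u * lam k)) / 2)).

Section log_laplace_series.
Variables (R : realType) (lam : nat -> R) (u : R).
Hypotheses (lam0 : forall k, 0 < lam k) (clam : cvgn (series lam)) (u0 : 0 <= u).

Lemma log_laplace_term_ge0 k : 0 <= ln (1 + 2 * (u * lam k)) / 2.
Proof.
have := mulr_ge0 u0 (ltW (lam0 k)) => ul.
by rewrite divr_ge0// ln_ge0//; lra.
Qed.

Lemma log_laplace_term_le k : ln (1 + 2 * (u * lam k)) / 2 <= u * lam k.
Proof.
have := mulr_ge0 u0 (ltW (lam0 k)) => ul.
have : ln (1 + 2 * (u * lam k)) <= 2 * (u * lam k) by rewrite le_ln1Dx//; lra.
lra.
Qed.

Lemma is_cvg_log_laplace :
  cvgn (series (fun k => ln (1 + 2 * (u * lam k)) / 2)).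
Proof.
apply: (@series_le_cvg _ _ (u *: lam)); last exact: is_cvg_seriesZ.
- exact: log_laplace_term_ge0.
- by move=> k; rewrite mulr_ge0// ltW.
- exact: log_laplace_term_le.
Qed.

End log_laplace_series.

Section small_ball_bounds.
Variables (R : realType) (d : measure_display) (T : measurableType d)
  (P : probability T R) (X : nat -> {RV P >-> R}) (lam : nat -> R).
Hypotheses (indep : mutually_independent X)
  (normal : forall n, standard_normal (X n))
  (lam0 : forall k, 0 < lam k) (clam : cvgn (series lam)).

Let S n w : R := \sum_(0 <= k < n) lam k * X k w ^+ 2.

Let mS n : measurable_fun setT (S n).
Proof.
apply: measurable_sum => k; apply: measurable_funM => //.
exact: measurable_funX.
Qed.

Let mexpS n v : measurable_fun setT (fun w => (expR (- v * S n w))%:E).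
Proof.
by apply/measurable_EFinP; apply: measurableT_comp => //; exact: measurable_funM.
Qed.

Let mSr n r : measurable [set w | S n w <= r].
Proof. by apply: measurable_set_pred; exact: measurable_fun_ler. Qed.

Lemma laplace_partial_sum n u : 0 <= u ->
  (\int[P]_w (expR (- u * S n w))%:E =
   (expR (- series (fun k => ln (1 + 2 * (u * lam k)) / 2) n))%:E)%E.
Proof.
move=> u0; have ul k : 0 <= u * lam k by rewrite mulr_ge0// ltW.
have := @expectation_prod _ _ _ P X n (fun k x => expR (- (u * lam k) * x ^+ 2)) indep.
have -> : (\prod_(k < n) \int[P]_w (expR (- (u * lam k) * X k w ^+ 2))%:E =
    (expR (- series (fun k => ln (1 + 2 * (u * lam k)) / 2) n))%:E)%E.
  under eq_bigr do rewrite expectation_expR_normal//.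
  by rewrite prodEFin -expR_sum sumrN seriesEord.
move=> <-.
- apply: eq_integral => w _; rewrite -expR_sum; congr (expR _)%:E.
  rewrite /S big_mkord mulr_sumr; apply: eq_bigr => k _.
  by rewrite !mulNr mulrA.
- move=> k; apply: measurableT_comp => //; apply: measurable_funM => //.
- move=> k x; rewrite expR_ge0 -expR0 ler_expR mulNr oppr_le0.
  by rewrite mulr_ge0// sqr_ge0.
Qed.

Let fin_sublevel n r : (P [set w | S n w <= r]) \is a fin_num.
Proof. exact: fin_num_measure. Qed.

(** Chernoff: the indicator of [S n w <= r] is at most [expR (u * (r - S n w))]. *)
Lemma partial_small_ball_le n (r u : R) : 0 <= u ->
  fine (P [set w | S n w <= r]) <=
  expR (u * r - series (fun k => ln (1 + 2 * (u * lam k)) / 2) n).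
Proof.
move=> u0; rewrite -lee_fin fineK// -[X in P X]setIT -integral_indic//.
rewrite expRD EFinM -laplace_partial_sum// -ge0_integralZl_EFin ?expR_ge0//.
apply: ge0_le_integral => //.
- by apply/measurable_EFinP; exact: measurable_indic.
- exact: emeasurable_funM.
move=> w _; rewrite -EFinM lee_fin -expRD indicE.
have [wr|wr] := boolP (w \in _); last by rewrite expR_ge0.
rewrite -expR0 ler_expR mulNr -mulrBr mulr_ge0// subr_ge0.
by move: wr; rewrite inE.
Qed.

(** [expR (- u * S n w)] is bounded on three regions, one per term on the right: between [a] and [r]
    by its value at [a]; above [r] and below [a] by Chernoff's trick, shifting [u] to [(1 - th) * u]
    and [(1 + th) * u]. *)
Lemma partial_small_ball_ge n (a r u th : R) : 0 <= u -> 0 <= th <= 1 ->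
  expR (- series (fun k => ln (1 + 2 * (u * lam k)) / 2) n) <=
  expR (- u * a) * fine (P [set w | S n w <= r]) +
  (expR (- (th * u) * r) *
     expR (- series (fun k => ln (1 + 2 * ((1 - th) * u * lam k)) / 2) n) +
   expR (th * u * a) *
     expR (- series (fun k => ln (1 + 2 * ((1 + th) * u * lam k)) / 2) n)).
Proof.
move=> u0 /andP[th0 th1].
have u1 : 0 <= (1 - th) * u by rewrite mulr_ge0// subr_ge0.
have u2 : 0 <= (1 + th) * u by rewrite mulr_ge0// addr_ge0.
have E0 := laplace_partial_sum n u0.
have E1 := laplace_partial_sum n u1.
have E2 := laplace_partial_sum n u2.
suff : (\int[P]_w (expR (- u * S n w))%:E <=
    (expR (- u * a))%:E * P [set w | (S n w <= r)%R] +
    ((expR (- (th * u) * r))%:E *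
       \int[P]_w (expR (- ((1 - th) * u) * S n w))%:E +
     (expR (th * u * a))%:E *
       \int[P]_w (expR (- ((1 + th) * u) * S n w))%:E))%E.
  by rewrite E0 E1 E2 -(fineK (fin_sublevel n r)) -!EFinM -!EFinD lee_fin.
rewrite -[X in P X]setIT -integral_indic//.
have m1 : measurable_fun setT (fun w => (\1_[set w | S n w <= r] w)%:E : \bar R).
  by apply/measurable_EFinP; exact: measurable_indic.
have mZ c (f : T -> \bar R) : measurable_fun setT f ->
    measurable_fun setT (fun w => c%:E * f w)%E.
  by move=> mf; exact: emeasurable_funM.
have pos c v w : (0 <= (expR c)%:E * (expR (- v * S n w))%:E)%E.
  by rewrite -EFinM lee_fin mulr_ge0 ?expR_ge0.
rewrite -(ge0_integralZl_EFin P measurableT (fun w _ => _) m1) ?expR_ge0//.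
rewrite -(ge0_integralZl_EFin P measurableT (fun w _ => _) (mexpS n ((1 - th) * u))) ?expR_ge0//.
rewrite -(ge0_integralZl_EFin P measurableT (fun w _ => _) (mexpS n ((1 + th) * u))) ?expR_ge0//.
rewrite -ge0_integralD//; [|exact: mZ..].
rewrite -ge0_integralD//; first last.
- by apply: emeasurable_funD; exact: mZ.
- by move=> w _; rewrite adde_ge0.
- exact: mZ.
apply: ge0_le_integral => //.
  by apply: emeasurable_funD; [|apply: emeasurable_funD]; exact: mZ.
move=> w _; rewrite -!EFinM -!EFinD lee_fin indicE -!expRD.
have [Sa|aS] := leP (S n w) a.
  rewrite -[leLHS]add0r lerD ?mulr_ge0 ?expR_ge0//.
  rewrite -[leLHS]add0r lerD ?expR_ge0// ler_expR.
  have : 0 <= th * u * (a - S n w) by rewrite !mulr_ge0// subr_ge0.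
  lra.
have [Sr|rS] := leP (S n w) r.
  rewrite mem_set//= mulr1 -[leLHS]addr0 lerD ?addr_ge0 ?expR_ge0//.
  by rewrite ler_expR !mulNr lerN2 ler_wpM2l// ltW.
rewrite -[leLHS]add0r lerD ?mulr_ge0 ?expR_ge0//.
rewrite -[leLHS]addr0 lerD ?expR_ge0// ler_expR.
have : 0 <= th * u * (S n w - r) by rewrite !mulr_ge0// subr_ge0 ltW.
lra.
Qed.

Let sublevelE r :
  [set w | (\sum_(0 <= n <oo) (lam n * X n w ^+ 2)%:E <= r%:E)%E] =
  \bigcap_n [set w | S n w <= r].
Proof.
have pos w k : (0 <= (lam k * X k w ^+ 2)%:E)%E.
  by rewrite lee_fin mulr_ge0 ?sqr_ge0// ltW.
apply/seteqP; split => w /= H.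
  move=> n _ /=; rewrite -lee_fin; apply: le_trans H.
  by rewrite /S -sumEFin; apply: nneseries_lim_ge.
apply: lime_le; first exact: is_cvg_nneseries.
by apply: nearW => n; rewrite sumEFin lee_fin; exact: H.
Qed.

(** Partial sums increase, so the events decrease to the event for the whole series; continuity from
    above applies. *)
Lemma small_ball_cvg r :
  fine (P [set w | S n w <= r]) @[n --> \oo] --> small_ball_probability X lam r.
Proof.
have mI : measurable (\bigcap_n [set w | S n w <= r]).
  exact: bigcap_measurableType.
rewrite /small_ball_probability sublevelE; apply: fine_cvg.
rewrite fineK; last exact: fin_num_measure.
apply: nonincreasing_cvg_mu => //.
- by rewrite (le_lt_trans (probability_le1 _ _))// ltry.
- move=> m n mn; rewrite subsetEset => w /=; apply: le_trans.
  rewrite /S (big_cat_nat (leq0n m) mn)//= lerDl sumr_ge0// => k _.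
  by rewrite mulr_ge0// ?sqr_ge0// ltW.
Qed.

Let cvg_expR_log_laplace v : 0 <= v ->
  expR (- series (fun k => ln (1 + 2 * (v * lam k)) / 2) n) @[n --> \oo] -->
  expR (- log_laplace lam v).
Proof.
move=> v0; apply: continuous_cvg; first exact: continuous_expR.
by apply: cvgN; exact: (is_cvg_log_laplace lam0 clam v0).
Qed.

Lemma small_ball_le (r u : R) : 0 <= u ->
  small_ball_probability X lam r <= expR (u * r - log_laplace lam u).
Proof.
move=> u0; apply: (ler_cvg_to (@small_ball_cvg r) _
    (nearW _ (fun n => partial_small_ball_le n r u0))).
rewrite expRD; under eq_fun do rewrite expRD.
by apply: cvgM; [exact: cvg_cst|exact: cvg_expR_log_laplace].
Qed.

Lemma small_ball_ge (a r u th : R) : 0 <= u -> 0 <= th <= 1 ->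
  expR (- log_laplace lam u) <=
  expR (- u * a) * small_ball_probability X lam r +
  (expR (- (th * u) * r) * expR (- log_laplace lam ((1 - th) * u)) +
   expR (th * u * a) * expR (- log_laplace lam ((1 + th) * u))).
Proof.
move=> u0 th01; have /andP[th0 th1] := th01.
apply: (ler_cvg_to (cvg_expR_log_laplace u0) _
    (nearW _ (fun n => @partial_small_ball_ge n a r u th u0 th01))).
apply: cvgD.
  by apply: cvgM; [exact: cvg_cst|exact: small_ball_cvg].
apply: cvgD; apply: cvgM; try exact: cvg_cst; apply: cvg_expR_log_laplace.
- by rewrite mulr_ge0// subr_ge0.
- by rewrite mulr_ge0// addr_ge0.
Qed.

End small_ball_bounds.

(** * The Laplace exponent and its derivative *)

(** The termwise derivative in [u] of the series [log_laplace]; [log_laplace_concave] is the link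
    between the two. *)
Definition tilted_mean (R : realType) (lam : nat -> R) (u : R) : R :=
  limn (series (fun k => lam k / (1 + 2 * (u * lam k)))).

Lemma ge_series_limn (R : realType) (a : nat -> R) n :
  (forall k, 0 <= a k) -> cvgn (series a) -> series a n <= limn (series a).
Proof.
move=> a0 ca; apply: nondecreasing_cvgn_le => //.
by apply: nondecreasing_series => k _ _.
Qed.

Lemma limn_series_ge0 (R : realType) (a : nat -> R) :
  (forall k, 0 <= a k) -> cvgn (series a) -> 0 <= limn (series a).
Proof.
by move=> a0 ca; have := ge_series_limn 0 a0 ca; rewrite seriesEnat /= big_geq.
Qed.

Lemma is_cvg_seriesMl (R : realType) (c : R) (a : nat -> R) :
  cvgn (series a) -> cvgn (series (fun k => c * a k)).
Proof. exact: (@is_cvg_seriesZ R a c). Qed.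

Lemma lim_seriesMl (R : realType) (c : R) (a : nat -> R) :
  cvgn (series a) -> limn (series (fun k => c * a k)) = c * limn (series a).
Proof. exact: (@lim_seriesZ R a c). Qed.

Lemma is_cvg_seriesDr (R : realType) (a b : nat -> R) :
  cvgn (series a) -> cvgn (series b) -> cvgn (series (fun k => a k + b k)).
Proof. exact: (@is_cvg_seriesD R a b). Qed.

Lemma lim_seriesDr (R : realType) (a b : nat -> R) :
  cvgn (series a) -> cvgn (series b) ->
  limn (series (fun k => a k + b k)) = limn (series a) + limn (series b).
Proof. exact: (@lim_seriesD R a b). Qed.

Section tilted_mean_theory.
Variables (R : realType) (lam : nat -> R).
Hypotheses (lam0 : forall k, 0 < lam k) (clam : cvgn (series lam)).

Let F := log_laplace lam.
Let D := tilted_mean lam.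

Let den_gt0 u k : 0 <= u -> 0 < 1 + 2 * (u * lam k).
Proof. by move=> u0; have := mulr_ge0 u0 (ltW (lam0 k)); lra. Qed.

Let den_gt1 u k : 0 <= u -> 1 <= 1 + 2 * (u * lam k).
Proof. by move=> u0; have := mulr_ge0 u0 (ltW (lam0 k)); lra. Qed.

Lemma tilted_mean_term_gt0 u k : 0 <= u -> 0 < lam k / (1 + 2 * (u * lam k)).
Proof. by move=> u0; rewrite divr_gt0// den_gt0. Qed.

Lemma is_cvg_tilted_mean u : 0 <= u ->
  cvgn (series (fun k => lam k / (1 + 2 * (u * lam k)))).
Proof.
move=> u0; apply: series_le_cvg clam => k.
- exact/ltW/tilted_mean_term_gt0.
- exact: ltW.
- by rewrite ler_pdivrMr ?den_gt0// ler_peMr ?(ltW (lam0 k))// den_gt1.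
Qed.

Lemma tilted_mean_gt0 u : 0 <= u -> 0 < D u.
Proof.
move=> u0; apply: (@lt_le_trans _ _ (series (fun k => lam k / (1 + 2 * (u * lam k))) 1)).
  by rewrite seriesEnat /= big_nat1 tilted_mean_term_gt0.
apply: ge_series_limn (is_cvg_tilted_mean u0) => k.
exact/ltW/tilted_mean_term_gt0.
Qed.

(** Tangent line bound, term by term: [ln (1 + z) <= z] applied to [1 + z = y / x]. *)
Lemma log_laplace_concave u v : 0 <= u -> 0 <= v ->
  F v <= F u + (v - u) * D u.
Proof.
move=> u0 v0.
have cF := is_cvg_log_laplace lam0 clam.
have cD := is_cvg_tilted_mean u0.
rewrite /F /D /log_laplace /tilted_mean.
rewrite -lim_seriesMl// -lim_seriesDr//; last 2 first.
- exact: cF.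
- exact: is_cvg_seriesMl.
apply: lim_series_le; [exact: cF| |move=> k].
  by apply: is_cvg_seriesDr; [exact: cF|exact: is_cvg_seriesMl].
set x := 1 + 2 * (u * lam k); set y := 1 + 2 * (v * lam k).
have x0 : 0 < x by exact: den_gt0.
have y0 : 0 < y by exact: den_gt0.
have yx : ln y = ln x + ln (1 + (y / x - 1)).
  rewrite -lnM ?posrE//; last by rewrite subrKC divr_gt0.
  by congr ln; field; rewrite gt_eqF.
rewrite yx; have : ln (1 + (y / x - 1)) <= y / x - 1.
  by apply: le_ln1Dx; rewrite ltrBDr addrC subrr divr_gt0.
have -> : y / x - 1 = 2 * ((v - u) * (lam k / x)).
  by rewrite -[1](@divff _ x) ?gt_eqF// -mulrBl /y /x; field; rewrite gt_eqF.
lra.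
Qed.

Lemma tilted_mean_anti u v : 0 <= v -> v <= u -> D u <= D v.
Proof.
move=> v0 vu; have u0 := le_trans v0 vu.
apply: lim_series_le; [exact: is_cvg_tilted_mean..|move=> k].
rewrite ler_pM2l// lef_pV2 ?posrE ?den_gt0// lerD2l ler_pM2l//.
by rewrite ler_pM2r.
Qed.

Lemma mul_tilted_mean_mono u v : 0 <= v -> v <= u -> v * D v <= u * D u.
Proof.
move=> v0 vu; have u0 := le_trans v0 vu.
rewrite -!lim_seriesMl; [|exact: is_cvg_tilted_mean..].
apply: lim_series_le; [exact/is_cvg_seriesMl/is_cvg_tilted_mean..|move=> k].
rewrite [leLHS]mulrA [leRHS]mulrA ler_pdivrMr ?den_gt0// mulrAC.
rewrite ler_pdivlMr ?den_gt0//.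
have := ler_wpM2r (ltW (lam0 k)) vu; nra.
Qed.

(** A term of [u * D u] is at least 1/3 as soon as [u * lam k >= 1]. [U] ensures this for the first
    [K] indices, with [K] above [3 * M]. *)
Lemma mul_tilted_mean_unbounded (M : R) :
  exists2 U, 0 < U & forall u, U <= u -> M <= u * D u.
Proof.
pose K := (Num.truncn (3 * `|M|)).+1.
pose U := 1 + \sum_(0 <= k < K) (lam k)^-1.
have sum0 : 0 <= \sum_(0 <= k < K) (lam k)^-1.
  by apply: sumr_ge0 => k _; rewrite invr_ge0 ltW.
have U0 : 0 < U by rewrite /U; lra.
exists U => // u Uu; apply: le_trans (mul_tilted_mean_mono (ltW U0) Uu).
have cU := is_cvg_tilted_mean (ltW U0).
apply: (@le_trans _ _ (U * series (fun k => lam k / (1 + 2 * (U * lam k))) K)).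
  rewrite seriesEnat /= mulr_sumr.
  apply: (@le_trans _ _ (\sum_(0 <= k < K) (3^-1 : R))).
    rewrite sumr_const_nat subn0 -mulr_natr.
    have : 3 * `|M| < K%:R by rewrite truncnS_gt.
    have := ler_norm M; lra.
  rewrite !big_nat; apply: ler_sum => k kK.
  rewrite [leRHS]mulrA ler_pdivlMr ?den_gt0 ?(ltW U0)//.
  have : 1 <= U * lam k.
    rewrite -ler_pdivrMr// div1r /U (bigD1_seq k) ?mem_index_iota ?iota_uniq//=.
    have : 0 <= \sum_(i <- index_iota 0 K | i != k) (lam i)^-1.
      by apply: sumr_ge0 => i _; rewrite invr_ge0 ltW.
    lra.
  lra.
rewrite ler_pM2l//; apply: ge_series_limn => // k.
exact/ltW/tilted_mean_term_gt0/ltW.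
Qed.

(** From [K] on the terms are at most [lam k], with total at most [s / 2]. Each of the first [K] is
    at most [(2 * u)^-1], and [u = K.+1 / s] brings their total below [s / 2]. *)
Lemma tilted_mean_small (s : R) : 0 < s -> exists2 u, 0 < u & D u <= s.
Proof.
move=> s0; set L := limn (series lam).
have [K _ HK] : \forall n \near \oo, `|L - series lam n| <= s / 2.
  by have /cvgrPdist_le := clam; apply; rewrite divr_gt0.
have LK : L - series lam K <= s / 2 by exact: le_trans (ler_norm _) (HK _ (leqnn K)).
pose u : R := K.+1%:R / s.
have u0 : 0 < u by rewrite divr_gt0.
have uu0 : 0 < 2 * u by rewrite mulr_gt0.
exists u => //; apply: limr_le; first exact/is_cvg_tilted_mean/ltW.
exists K => // n /= Kn; rewrite seriesEnat /= (big_cat_nat (leq0n K) Kn) /=.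
apply: (@le_trans _ _ (s / 2 + (series lam n - series lam K))); last first.
  have : series lam n <= L by apply: ge_series_limn => // k; exact: ltW.
  lra.
apply: lerD.
  apply: (@le_trans _ _ (\sum_(0 <= k < K) (2 * u)^-1)).
    apply: ler_sum => k _; rewrite ler_pdivrMr ?den_gt0 ?(ltW u0)//.
    rewrite mulrC ler_pdivlMr//.
    have := lam0 k; nra.
  rewrite sumr_const_nat subn0 -[leLHS]mulr_natr ler_pdivrMl//.
  have -> : 2 * u * (s / 2) = K.+1%:R by rewrite /u; field; rewrite gt_eqF.
  by rewrite ler_nat.
rewrite (sub_series_geq _ Kn); apply: ler_sum => k _.
by rewrite ler_pdivrMr ?den_gt0 ?(ltW u0)// ler_peMr ?(ltW (lam0 k))// den_gt1// ltW.
Qed.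

(** Intermediate values. Continuity comes from monotonicity alone: since [D] decreases and [u * D u]
    increases, [D] is Lipschitz on the half-line from [U] on. *)
Lemma tilted_mean_surj (U s : R) : 0 < U -> 0 < s -> s < D U ->
  exists2 u, U <= u & D u = s.
Proof.
move=> U0 s0 sU.
have [V V0 DV] := tilted_mean_small s0.
have UV : U <= V.
  rewrite leNgt; apply/negP => VU.
  by have := tilted_mean_anti (ltW V0) (ltW VU); lra.
(* Freezing [D] below [U] makes the Lipschitz bound global. *)
pose f x := D (Num.max U x).
have fle x y : x <= y -> 0 <= f x - f y <= (D U / U) * (y - x).
  move=> xy; set a := Num.max U x; set b := Num.max U y.
  have Ua : U <= a by rewrite le_max lexx.
  have ab : a <= b by rewrite ge_max !le_max lexx xy orbT.
  have a0 : 0 < a by exact: lt_le_trans Ua.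
  have bya : b - a <= y - x.
    by rewrite /a /b !maxEle; case: ifPn; case: ifPn; rewrite -?ltNge; lra.
  have h1 := tilted_mean_anti (ltW a0) ab.
  have h2 := mul_tilted_mean_mono (ltW a0) ab.
  have h3 := tilted_mean_anti (ltW U0) Ua.
  have h4 := tilted_mean_anti (ltW U0) (le_trans Ua ab).
  have h5 := tilted_mean_gt0 (ltW U0).
  rewrite /f -/a -/b subr_ge0 h1 /= mulrAC ler_pdivlMr//.
  have : 0 <= (D a - D b) * (a - U) by rewrite mulr_ge0// subr_ge0.
  have : 0 <= (D U - D b) * (b - a) by rewrite mulr_ge0// subr_ge0.
  have : 0 <= D U * ((y - x) - (b - a)) by rewrite mulr_ge0 ?subr_ge0// ltW.
  lra.
have cf : continuous f.
  move=> x; apply/cvgrPdist_le => e e0.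
  have k0 : 0 < D U / U by rewrite divr_gt0// tilted_mean_gt0// ltW.
  near=> y.
  have xye : `|x - y| <= e / (D U / U).
    near: y; apply: (@cvgr_dist_le _ _ _ _ _ id x); first exact: cvg_id.
    by rewrite divr_gt0.
  rewrite ler_pdivlMr// mulrC in xye; apply: le_trans xye.
  have [xy|/ltW yx] := leP x y.
    have /andP[f0 fl] := fle _ _ xy.
    by rewrite ger0_norm// distrC ger0_norm ?subr_ge0.
  have /andP[f0 fl] := fle _ _ yx.
  by rewrite distrC ger0_norm// ger0_norm ?subr_ge0.
have fU : f U = D U by rewrite /f maxxx.
have fV : f V = D V by rewrite /f; congr D; exact/max_idPr.
have [||u uUV fu] := @IVT R f U V s UV.
- exact: continuous_subspaceT.
- by rewrite fU fV ge_min le_max DV (ltW sU) orbT.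
move: uUV; rewrite in_itv /= => /andP[Uu _].
by exists u => //; rewrite -fu /f; congr D; exact/esym/max_idPr.
Unshelve. all: by end_near.
Qed.

(* With [t = 2 u lam k], the deficit [F u - u D u] is half the sum of
   [ln (1 + t) - t / (1 + t)], which is at least [1/16] as soon as [1 <= t]. *)
Lemma log_laplace_deficit (c delta : R) : 0 < c -> 0 < delta ->
  (forall x, 0 < x < delta ->
    (1 + c) * limn (series (fun k => Num.min (lam k) x)) <=
    limn (series (fun k => Num.min (lam k) (2 * x)))) ->
  exists2 U, 0 < U & forall u, U <= u -> u * D u <= 16 / c * (F u - u * D u).
Proof.
move=> c0 delta0 H; exists delta^-1; first by rewrite invr_gt0.
move=> u Uu; have u0 : 0 < u by apply: lt_le_trans Uu; rewrite invr_gt0.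
(* The level at which [t = 1]; [u >= delta^-1] puts it below [delta]. *)
pose x := (2 * u)^-1.
have x0 : 0 < x by rewrite invr_gt0 mulr_gt0.
have ux : 2 * u * x = 1 by rewrite divff// gt_eqF// mulr_gt0.
have xd : x < delta.
  have : 1 <= u * delta by rewrite -ler_pdivrMr// div1r.
  nra.
have cF := is_cvg_log_laplace lam0 clam (ltW u0).
have cD := is_cvg_tilted_mean (ltW u0).
have cmin y := @is_cvg_series_min _ _ y lam0 clam.
have Dmin : u * D u <= u * limn (series (fun k => Num.min (lam k) x)).
  rewrite ler_pM2l//; apply: lim_series_le; [exact: cD|exact: cmin|move=> k].
  have lk := lam0 k; have dk := den_gt0 k (ltW u0).
  rewrite le_min !ler_pdivrMr//.
  have : 0 <= lam k * (u * lam k) by rewrite !mulr_ge0// ltW.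
  by move=> ?; apply/andP; split; nra.
(* Doubling the truncation level gains nothing if [lam k <= x] and at most [x] otherwise, and then
   [t >= 1], so that the deficit pays for it. *)
have deficit k : Num.min (lam k) (2 * x) <= Num.min (lam k) x +
    16 / u * (ln (1 + 2 * (u * lam k)) / 2 + (- u) * (lam k / (1 + 2 * (u * lam k)))).
  have lk := lam0 k; have dk := den_gt0 k (ltW u0).
  set y := ln (1 + 2 * (u * lam k)) / 2.
  (* [q = (1 + t)^(-1/2)], so [1 - q * q = t / (1 + t)]. From [1 - y <= q] the quantity
     [ln (1 + t) - t / (1 + t)] is at least [(1 - q)^2], and [t >= 1] gives [q <= 3 / 4], whence the
     1/16. *)
  pose q := expR (- y).
  have q0 : 0 < q by exact: expR_gt0.
  have q2 : q * q = (1 + 2 * (u * lam k))^-1.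
    rewrite -expRD -[RHS]lnK ?posrE ?invr_gt0// lnV ?posrE//.
    by congr expR; rewrite /y; field.
  have qy : 1 - y <= q by exact: expR_ge1Dx.
  have -> : lam k / (1 + 2 * (u * lam k)) = (1 - q * q) / (2 * u).
    by rewrite q2; field; rewrite !gt_eqF.
  have -> : 16 / u * (y + - u * ((1 - q * q) / (2 * u))) =
      16 * x * (2 * y - (1 - q * q)).
    by rewrite /x; field; rewrite gt_eqF.
  have phi : (1 - q) * (1 - q) <= 2 * y - (1 - q * q) by lra.
  have [lx|xl] := leP (lam k) x.
    rewrite (min_idPl _); last by lra.
    have : 0 <= x * ((1 - q) * (1 - q)) by rewrite mulr_ge0 ?(ltW x0)// -expr2 sqr_ge0.
    nra.
  have : Num.min (lam k) (2 * x) <= 2 * x by rewrite ge_min lexx orbT.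
  have q34 : q <= 3 / 4.
    have : 1 <= 2 * (u * lam k) by nra.
    have : q * q * (1 + 2 * (u * lam k)) = 1 by rewrite q2 mulVf// gt_eqF.
    nra.
  have : x * (1 / 16) <= x * (2 * y - (1 - q * q)) by rewrite ler_pM2l//; nra.
  lra.
have Hx := H x; rewrite x0 xd in Hx; have {Hx}H := Hx isT.
have cE : cvgn (series (fun k => ln (1 + 2 * (u * lam k)) / 2 +
    (- u) * (lam k / (1 + 2 * (u * lam k))))).
  by apply: is_cvg_seriesDr => //; exact: is_cvg_seriesMl.
have x20 : 0 < 2 * x by rewrite mulr_gt0.
have := lim_series_le (cmin (2 * x) x20)
  (is_cvg_seriesDr (cmin x x0) (@is_cvg_seriesMl _ (16 / u) _ cE)) deficit.
rewrite (lim_seriesDr (cmin x x0) (@is_cvg_seriesMl _ (16 / u) _ cE)).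
rewrite (lim_seriesMl _ cE) (lim_seriesDr cF (@is_cvg_seriesMl _ (- u) _ cD)).
rewrite (lim_seriesMl _ cD) -/(tilted_mean lam u) -/(log_laplace lam u) -/(D u) -/(F u).
move=> /(le_trans H) H2.
have : c * (u * limn (series (fun k => Num.min (lam k) x))) <= 16 * (F u - u * D u).
  rewrite mulrCA -ler_pdivlMl//.
  have -> : u^-1 * (16 * (F u - u * D u)) = 16 / u * (F u - u * D u) by ring.
  lra.
move=> H3; rewrite mulrAC ler_pdivlMr// mulrC; apply: le_trans H3.
by rewrite ler_pM2l.
Qed.

End tilted_mean_theory.

(** * Comparison of two sequences *)

(* The truncation at [delta] confines the comparison to the levels where the
   counting functions are known to be comparable; [y] inverts [g]. *)
Lemma le_series_truncated (R : realType) (lam lam' : nat -> R) (a delta : R)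
    (g y : R -> R) :
  (forall k, 0 < lam k) -> (forall k, 0 < lam' k) -> 0 <= a -> 0 < delta ->
  (forall x, 0 < x < delta ->
    counting_function lam x <= a * counting_function lam' x) ->
  (forall s, 0 < s -> 0 < y s) ->
  (forall s z, 0 < s -> 0 < z -> (s < g z) = (y s < z)) ->
  (forall z, 0 < z -> 0 <= g z) ->
  cvgn (series (fun k => g (Num.min (lam k) delta))) ->
  cvgn (series (fun k => g (Num.min (lam' k) delta))) ->
  limn (series (fun k => g (Num.min (lam k) delta))) <=
  a * limn (series (fun k => g (Num.min (lam' k) delta))).
Proof.
move=> lam0 lam'0 a0 delta0 H y0 gy g0 c c'.
have min0 (l : nat -> R) k : (forall k, 0 < l k) -> 0 < Num.min (l k) delta.
  by move=> l0; rewrite lt_min l0 delta0.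
apply: le_series_of_counting => // [k|k|s s0].
- exact/g0/min0.
- exact/g0/min0.
have E (l : nat -> R) : (forall k, 0 < l k) -> y s < delta ->
    counting_function (fun k => g (Num.min (l k) delta)) s =
    counting_function l (y s).
  move=> l0 ys; apply: eq_counting_function => k.
  by rewrite gy ?min0// lt_min ys andbT.
have [ys|ys] := ltP (y s) delta.
  by rewrite !E// H// y0.
rewrite [leLHS](_ : _ = 0) ?mulr_ge0 ?counting_function_ge0//.
rewrite /counting_function (_ : [set n | _] = set0) ?fset_set0 ?cardfs0//.
apply/seteqP; split=> k //=.
by rewrite gy ?min0// lt_min (ltNge _ delta) ys andbF.
Qed.

Lemma series_min_comparison (R : realType) (lam lam' : nat -> R) (a delta x : R) :
  (forall k, 0 < lam k) -> (forall k, 0 < lam' k) ->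
  cvgn (series lam) -> cvgn (series lam') -> 0 <= a -> 0 < x <= delta ->
  (forall x, 0 < x < delta ->
    counting_function lam x <= a * counting_function lam' x) ->
  limn (series (fun k => Num.min (lam k) x)) <=
  a * limn (series (fun k => Num.min (lam' k) x)).
Proof.
move=> lam0 lam'0 clam clam' a0 /andP[x0 xd] H.
apply: (@le_series_truncated _ _ _ _ _ id id) => //.
- by move=> z /andP[z0 zx]; apply: H; rewrite z0 (lt_le_trans zx).
- by move=> z /ltW.
- exact: is_cvg_series_min.
- exact: is_cvg_series_min.
Qed.

(** Truncation at [delta] decreases the right side, and costs the left side at most [lam k / delta]
    per term, because [ln r <= r - 1]. Hence a constant [K] that does not depend on [u]. *)
Lemma log_laplace_comparison (R : realType) (lam lam' : nat -> R) (a delta : R) :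
  (forall k, 0 < lam k) -> (forall k, 0 < lam' k) ->
  cvgn (series lam) -> cvgn (series lam') -> 0 <= a -> 0 < delta ->
  (forall x, 0 < x < delta ->
    counting_function lam x <= a * counting_function lam' x) ->
  exists2 K, 0 <= K &
    forall u, 0 < u -> log_laplace lam u <= a * log_laplace lam' u + K.
Proof.
move=> lam0 lam'0 clam clam' a0 delta0 H.
have L0 : 0 <= limn (series lam) by apply: limn_series_ge0 => // k; exact: ltW.
exists (delta^-1 * limn (series lam)); first by rewrite mulr_ge0// invr_ge0 ltW.
move=> u u0.
pose g (z : R) : R := ln (1 + 2 * (u * z)) / 2.
pose y (s : R) : R := (expR (2 * s) - 1) / (2 * u).
have uu0 : 0 < 2 * u by rewrite mulr_gt0.
have g0 z : 0 < z -> 0 <= g z.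
  by move=> z0; rewrite divr_ge0// ln_ge0//; have := mulr_gt0 u0 z0; lra.
have gmono z z' : 0 < z -> z <= z' -> g z <= g z'.
  move=> z0 zz'; have z'0 := lt_le_trans z0 zz'.
  rewrite ler_pM2r// ler_ln ?posrE.
  - by rewrite lerD2l ler_pM2l// ler_pM2l.
  - by have := mulr_gt0 u0 z0; lra.
  - by have := mulr_gt0 u0 z'0; lra.
have cg (l : nat -> R) : (forall k, 0 < l k) -> cvgn (series l) ->
    cvgn (series (fun k => g (Num.min (l k) delta))).
  move=> l0 cl; apply: series_le_cvg (is_cvg_log_laplace l0 cl (ltW u0)) => k.
  - by apply: g0; rewrite lt_min l0.
  - exact: g0.
  - by apply: gmono; rewrite ?lt_min ?l0// ge_min lexx.
have trunc := @le_series_truncated R lam lam' a delta g y lam0 lam'0 a0 delta0 H.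
have {}trunc : limn (series (fun k => g (Num.min (lam k) delta))) <=
    a * limn (series (fun k => g (Num.min (lam' k) delta))).
  apply: trunc => //; [|move=> s z s0 z0|exact: cg|exact: cg].
    by move=> s s0; rewrite divr_gt0// subr_gt0 expR_gt1 mulr_gt0.
  have z1 : 0 < 1 + 2 * (u * z) by have := mulr_gt0 u0 z0; lra.
  rewrite /g /y ltr_pdivlMr// ltr_pdivrMr// mulrC -{1}(expRK (2 * s)).
  rewrite ltr_ln ?posrE ?expR_gt0// ltrBlDl.
  by congr (_ < 1 + _); ring.
have up : log_laplace lam u <=
    limn (series (fun k => g (Num.min (lam k) delta))) +
    delta^-1 * limn (series lam).
  rewrite -lim_seriesMl// -lim_seriesDr//; [|exact: cg|exact: is_cvg_seriesMl].
  apply: lim_series_le; first exact/is_cvg_log_laplace/ltW.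
    by apply: is_cvg_seriesDr; [exact: cg|exact: is_cvg_seriesMl].
  move=> k; rewrite -/(g (lam k)); have lk := lam0 k.
  have [ld|dl] := leP (lam k) delta.
    by rewrite lerDl mulr_ge0 ?invr_ge0 ?(ltW delta0) ?(ltW lk).
  pose r := (1 + 2 * (u * lam k)) / (1 + 2 * (u * delta)).
  have ud := mulr_gt0 u0 delta0; have ul := mulr_gt0 u0 lk.
  have d1 : 0 < 1 + 2 * (u * delta) by lra.
  have l1 : 0 < 1 + 2 * (u * lam k) by lra.
  have r0 : 0 < r by rewrite divr_gt0.
  have -> : g (lam k) = g delta + ln r / 2.
    rewrite /g /r ln_div ?posrE//; lra.
  rewrite lerD2l; have lnr : ln r <= r - 1.
    by rewrite -{1}(subrKC 1 r) le_ln1Dx// ltrBDr addrC subrr.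
  have : r <= delta^-1 * lam k.
    rewrite mulrC ler_pdivrMr// mulrAC ler_pdivlMr//; nra.
  have : 0 <= ln r.
    rewrite ln_ge0// ler_pdivlMr// mul1r lerD2l ler_pM2l// ler_pM2l//.
    exact: ltW.
  lra.
apply: le_trans up _; rewrite lerD2r; apply: le_trans trunc _.
rewrite ler_wpM2l//; apply: lim_series_le.
- exact: cg.
- exact/is_cvg_log_laplace/ltW.
- by move=> k; apply: gmono; rewrite ?lt_min ?lam'0// ge_min lexx.
Qed.

(** * Lower bound by tilting and comparison of the logarithms *)

(* The exponential tilting by [u] concentrates the sum around [s = tilted_mean lam u]:
   with [th = eta / (2 + eta)] the tilted mass outside [(1 - eta) s, (1 + eta) s]
   is at most [2 exp (-3)]. *)
Lemma small_ball_lower (R : realType) d (T : measurableType d)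
    (P : probability T R) (X : nat -> {RV P >-> R}) (lam : nat -> R)
    (eta u : R) :
  mutually_independent X -> (forall n, standard_normal (X n)) ->
  (forall k, 0 < lam k) -> cvgn (series lam) -> 0 < eta -> 0 < u ->
  6 <= eta / (2 + eta) * eta * (u * tilted_mean lam u) ->
  expR (- log_laplace lam u + (1 - eta) * (u * tilted_mean lam u)) / 2 <=
  small_ball_probability X lam ((1 + eta) * tilted_mean lam u).
Proof.
move=> indep normal lam0 clam eta0 u0.
set s := tilted_mean lam u; set th := eta / (2 + eta); set W := u * s => HW.
have d0 : 0 < 2 + eta by lra.
have thE : th * (2 + eta) = eta by rewrite /th mulfVK// gt_eqF.
have th0 : 0 < th by rewrite divr_gt0.
have th1 : th < 1 by rewrite ltr_pdivrMr// mul1r; lra.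
have W0 : 0 < W by rewrite mulr_gt0// tilted_mean_gt0// ltW.
have v0 : 0 < (1 - th) * u by rewrite mulr_gt0// subr_gt0.
have w0 : 0 < (1 + th) * u by rewrite mulr_gt0// addr_gt0.
have th01 : 0 <= th <= 1 by rewrite !ltW.
have := small_ball_ge indep normal lam0 clam ((1 - eta) * s) ((1 + eta) * s) (ltW u0) th01.
set p := small_ball_probability _ _ _.
set F := log_laplace lam.
(* Upper tail. Concavity at [(1 - th) * u] bounds the increment of [F] by [th / (1 - th) * W], which
   is [eta / 2 * W] by the choice of [th]; what remains is [th * eta * W / 2 >= 3]. *)
have h2 : - (th * u) * ((1 + eta) * s) - F ((1 - th) * u) <= - F u - 3.
  have := log_laplace_concave lam0 clam (ltW v0) (ltW u0).
  have vu : (1 - th) * u <= u by nra.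
  have := mul_tilted_mean_mono lam0 clam (ltW v0) vu.
  rewrite -/F -/s -/W; set Dv := tilted_mean _ _ => m1 m2.
  have m3 : (1 - th) * (th * (u * Dv)) <= th * W.
    have -> : (1 - th) * (th * (u * Dv)) = th * ((1 - th) * u * Dv) by ring.
    by rewrite ler_pM2l.
  have e1 : th * 2 = eta * (1 - th) by lra.
  have m4 : th * (u * Dv) <= eta / 2 * W.
    rewrite -(@ler_pM2l _ (1 - th)) ?subr_gt0//.
    have -> : (1 - th) * (eta / 2 * W) = (eta * (1 - th)) * W / 2 by field.
    by rewrite -e1; lra.
  have e2 : th * (1 + eta) * W - eta / 2 * W = th * eta * W / 2.
    by rewrite -{2}thE; field.
  have -> : - (th * u) * ((1 + eta) * s) = - (th * (1 + eta) * W) by rewrite /W; ring.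
  have m5 : F u <= F ((1 - th) * u) + th * (u * Dv).
    by apply: le_trans m2 _; rewrite lerD2l; lra.
  lra.
(* Lower tail, with the tangent at [(1 + th) * u]; the choice of [th] enters through
   [(1 + th) * (1 - eta / 2) <= 1]. *)
have h3 : th * u * ((1 - eta) * s) - F ((1 + th) * u) <= - F u - 3.
  have := log_laplace_concave lam0 clam (ltW w0) (ltW u0).
  have uw : u <= (1 + th) * u by nra.
  have := mul_tilted_mean_mono lam0 clam (ltW u0) uw.
  rewrite -/F -/s -/W; set Dw := tilted_mean _ _ => m1 m2.
  have m5 : F u <= F ((1 + th) * u) - th * (u * Dw).
    by apply: le_trans m2 _; rewrite lerD2l; lra.
  have m3 : th * W <= (1 + th) * (th * (u * Dw)).
    have -> : (1 + th) * (th * (u * Dw)) = th * ((1 + th) * u * Dw) by ring.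
    by rewrite ler_pM2l.
  have -> : th * u * ((1 - eta) * s) = th * (1 - eta) * W by rewrite /W; ring.
  suff : th * (1 - eta) * W + th * eta * W / 2 <= th * (u * Dw) by lra.
  rewrite -(@ler_pM2l _ (1 + th)); last by lra.
  apply: le_trans m3.
  have -> : (1 + th) * (th * (1 - eta) * W + th * eta * W / 2) =
    (th * W) * ((1 + th) * (1 - eta / 2)) by field.
  rewrite ler_piMr//; first by rewrite ltW// mulr_gt0.
  nra.
rewrite -!expRD => H.
(* Each tail thus takes at most a quarter of the mass, which leaves one half for the middle. *)
have e3 : expR (- 3) <= 4^-1 :> R.
  rewrite expRN lef_pV2 ?posrE ?expR_gt0//.
  by apply: le_trans (expR_ge1Dx _); lra.
have h2' : expR (- (th * u) * ((1 + eta) * s) - F ((1 - th) * u)) <= expR (- F u) / 4.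
  apply: (@le_trans _ _ (expR (- F u - 3))); first by rewrite ler_expR.
  by rewrite expRD ler_pM2l ?expR_gt0.
have h3' : expR (th * u * ((1 - eta) * s) - F ((1 + th) * u)) <= expR (- F u) / 4.
  apply: (@le_trans _ _ (expR (- F u - 3))); first by rewrite ler_expR.
  by rewrite expRD ler_pM2l ?expR_gt0.
have : expR (- F u) / 2 <= expR (- u * ((1 - eta) * s)) * p by lra.
have -> : - u * ((1 - eta) * s) = - ((1 - eta) * W) by rewrite /W; ring.
rewrite (expRN ((1 - eta) * W)) ler_pdivlMl ?expR_gt0// => H2.
by apply: le_trans H2; rewrite expRD; lra.
Qed.

(** Positivity is what makes the logarithms monotone in the estimates below. *)
Lemma small_ball_gt0 (R : realType) d (T : measurableType d)
    (P : probability T R) (X : nat -> {RV P >-> R}) (lam : nat -> R) :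
  mutually_independent X -> (forall n, standard_normal (X n)) ->
  (forall k, 0 < lam k) -> cvgn (series lam) ->
  exists2 rho, 0 < rho &
    forall r, 0 < r < rho -> 0 < small_ball_probability X lam r.
Proof.
move=> indep normal lam0 clam.
(* With [eta = 1] the factor [eta / (2 + eta) * eta] is 1/3, and [18 / 3 = 6]. *)
have [U U0 HU] := mul_tilted_mean_unbounded lam0 clam 18.
have DU := tilted_mean_gt0 lam0 clam (ltW U0).
exists (2 * tilted_mean lam U); first by rewrite mulr_gt0.
move=> r /andP[r0 rU].
have [||u Uu Du] := tilted_mean_surj lam0 clam U0 (_ : 0 < r / 2) (_ : r / 2 < _).
- by rewrite divr_gt0.
- lra.
have u0 := lt_le_trans U0 Uu.
have := small_ball_lower indep normal lam0 clam (ltr01 : 0 < 1) u0.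
have := HU u Uu; rewrite Du => H6 /(_ _).
have -> : (1 + 1) * (r / 2) = r by field.
move=> H; apply: lt_le_trans (H _); first by rewrite divr_gt0// expR_gt0.
have -> : 1 / (2 + 1) * 1 = 3^-1 :> R by field.
lra.
Qed.

(** One [u] serves both sequences: it is the tilting adapted to [lam'], and the Chernoff parameter
    for [lam]. Both logarithms are then compared with [G], the deficit for [lam'], which dominates
    [W] up to the factor [C]. *)
Lemma log_small_ball_comparison (R : realType) d (T : measurableType d)
    (P : probability T R) (X : nat -> {RV P >-> R}) (lam lam' : nat -> R)
    (C U : R) :
  mutually_independent X -> (forall n, standard_normal (X n)) ->
  (forall k, 0 < lam k) -> cvgn (series lam) ->
  (forall k, 0 < lam' k) -> cvgn (series lam') ->
  0 < C -> 0 < U ->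
  (forall u, U <= u -> u * tilted_mean lam' u <=
     C * (log_laplace lam' u - u * tilted_mean lam' u)) ->
  (forall a, 1 < a -> exists2 K, 0 <= K &
     forall u, 0 < u -> log_laplace lam' u <= a * log_laplace lam u + K) ->
  forall e, 0 < e <= 1 -> exists2 rho, 0 < rho & forall r, 0 < r < rho ->
    0 < - ln (small_ball_probability X lam r) /\
    - ln (small_ball_probability X lam' r) <=
    (1 + e) * - ln (small_ball_probability X lam r).
Proof.
move=> indep normal lam0 clam lam'0 clam' C0 U0 HC comp e /andP[e0 e1].
have [rho1 rho10 pos1] := small_ball_gt0 indep normal lam0 clam.
(* The errors proportional to [G] add up to at most [eta * (2 + 5 * C) * G], half of [e * G]; the
   other half absorbs the constants [1 + 2 * K]. *)
pose eta := e / (2 * (2 + 5 * C)).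
have dC : 0 < 2 * (2 + 5 * C) by lra.
have eta0 : 0 < eta by rewrite divr_gt0.
have etaE : eta * (2 * (2 + 5 * C)) = e by rewrite /eta mulfVK// gt_eqF.
clearbody eta.
have [K K0 HK] := comp (1 + eta) ltac:(lra).
pose th := eta / (2 + eta).
have d2 : 0 < 2 + eta by lra.
have th0 : 0 < th by rewrite divr_gt0.
(* The first entry meets the condition of [small_ball_lower]; the second, through [W <= C * G],
   makes [e * G] at least [2 * (1 + 2 * K)]. *)
pose M := Num.max (6 / (th * eta)) (C * (2 * (1 + 2 * K) / e)).
have [U1 U10 HU1] := mul_tilted_mean_unbounded lam'0 clam' M.
pose U2 := Num.max U U1.
have U20 : 0 < U2 by rewrite lt_max U0.
have DU := tilted_mean_gt0 lam'0 clam' (ltW U20).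
exists (Num.min rho1 (tilted_mean lam' U2)); first by rewrite lt_min rho10.
move=> r /andP[r0]; rewrite lt_min => /andP[rrho rU].
have s0 : 0 < r / (1 + eta) by rewrite divr_gt0//; lra.
have sr : r / (1 + eta) < tilted_mean lam' U2.
  by apply: le_lt_trans rU; rewrite ler_pdivrMr; nra.
have [u Uu Du] := tilted_mean_surj lam'0 clam' U20 s0 sr.
have u0 := lt_le_trans U20 Uu.
have UU : U <= u by apply: le_trans Uu; rewrite le_max lexx.
have U1u : U1 <= u by apply: le_trans Uu; rewrite le_max lexx orbT.
have := HU1 u U1u; rewrite ge_max => /andP[M1 M2].
have := HC u UU.
have := small_ball_lower indep normal lam'0 clam' eta0 u0.
set s := tilted_mean lam' u in Du M1 M2 *; set W := u * s in M1 M2 *.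
have rs : (1 + eta) * s = r by rewrite Du mulrC mulfVK// gt_eqF//; lra.
rewrite rs -/th => lower.
have /lower{}lower : 6 <= th * eta * W.
  by rewrite mulrC -ler_pdivrMr//; exact: mulr_gt0.
set G := log_laplace lam' u - W => WG.
have FE : log_laplace lam' u = G + W by rewrite /G subrK.
have upper : - ln (small_ball_probability X lam' r) <= G + eta * W + 1.
  have p0 : 0 < expR (- log_laplace lam' u + (1 - eta) * W) / 2.
    by rewrite divr_gt0// expR_gt0.
  have : ln (expR (- log_laplace lam' u + (1 - eta) * W) / 2) <=
      ln (small_ball_probability X lam' r).
    by rewrite ler_ln ?posrE// (lt_le_trans p0).
  rewrite ln_div ?posrE ?expR_gt0// expRK FE.
  have : ln 2 <= 1 :> R.
    have -> : 2 = 1 + 1 :> R by [].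
    by apply: le_ln1Dx; lra.
  lra.
have low : log_laplace lam u - u * r <= - ln (small_ball_probability X lam r).
  have p0 : 0 < small_ball_probability X lam r by apply: pos1; rewrite r0.
  have := small_ball_le indep normal lam0 clam r (ltW u0).
  rewrite -ler_ln ?posrE ?expR_gt0// expRK; lra.
have ur : u * r = (1 + eta) * W by rewrite -rs /W; ring.
have Fcomp := HK u u0.
have W0 : 0 < W by rewrite /W Du mulr_gt0.
have G0 : 0 < G by rewrite -(pmulr_rgt0 _ C0) (lt_le_trans W0).
have GK : 2 * (1 + 2 * K) <= G * e.
  rewrite -ler_pdivrMr// -(@ler_pM2l _ C)//.
  exact: le_trans WG.
rewrite FE in Fcomp.
have eta1 : eta <= 1 by nra.
(* The factor [1 + eta] is inverted by means of [(1 - eta) * (1 + eta) <= 1]. *)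
have Fl : (1 - eta) * (G + W) - K <= log_laplace lam u.
  have h1 : (1 - eta) * (G + W) <= (1 - eta) * ((1 + eta) * log_laplace lam u + K).
    by rewrite ler_wpM2l// subr_ge0.
  have : 0 <= log_laplace lam u.
    apply: limn_series_ge0 (is_cvg_log_laplace lam0 clam (ltW u0)) => k.
    exact: (log_laplace_term_ge0 lam0 (ltW u0)).
  nra.
set A := - ln (small_ball_probability X lam r) in low *.
have A1 : G - eta * (1 + 2 * C) * G - K <= A.
  have : eta * W <= eta * (C * G) by rewrite ler_pM2l.
  lra.
have eG : eta * (2 * (2 + 5 * C)) * G = e * G by rewrite etaE.
have CG0 : 0 < C * G by rewrite mulr_gt0.
have etaG : 0 < eta * G by rewrite mulr_gt0.
have etaCG : 0 < eta * (C * G) by rewrite mulr_gt0.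
have eG1 : e * G <= G by nra.
split.
  lra.
apply: (@le_trans _ _ (G + eta * (C * G) + 1)).
  have : eta * W <= eta * (C * G) by rewrite ler_pM2l.
  lra.
apply: (@le_trans _ _ ((1 + e) * (G - eta * (1 + 2 * C) * G - K))); last first.
  by rewrite ler_pM2l//; lra.
have : e * (eta * G) <= eta * G by nra.
have : e * (eta * (C * G)) <= eta * (C * G) by nra.
have : e * K <= K by nra.
lra.
Qed.

(** * Counting functions near zero and the doubling condition *)

Lemma at_right0P (R : realType) (Q : R -> Prop) :
  (\forall x \near 0^'+, Q x) <->
  exists2 rho : R, 0 < rho & forall x, 0 < x < rho -> Q x.
Proof.
split=> -[rho /= rho0 H]; exists rho => //= x.
  move=> /andP[x0 xrho]; apply: H => //=.
  by rewrite sub0r normrN gtr0_norm.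
move=> xrho x0; apply: H; rewrite x0 /=.
by move: xrho; rewrite /= sub0r normrN gtr0_norm.
Qed.

Lemma ratio_equiv_counting (R : realType) (lam lam' : nat -> R) (a : R) :
  ratio_equiv 0^'+ (counting_function lam) (counting_function lam') -> 1 < a ->
  exists2 delta : R, 0 < delta & forall x, 0 < x < delta ->
    counting_function lam x <= a * counting_function lam' x /\
    counting_function lam' x <= a * counting_function lam x.
Proof.
move=> H a1; have a0 : 0 < a by lra.
(* This tolerance is [1 - a^-1]: the ratio lies between [a^-1] and [2 - a^-1], and the latter is at
   most [a]. *)
have e0 : 0 < (a - 1) / a by rewrite divr_gt0// subr_gt0.
have /cvgrPdist_le/(_ _ e0)/at_right0P[delta delta0 Hd] := H.
exists delta => // x /Hd {Hd}.
set N := counting_function lam x; set N' := counting_function lam' x.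
have N0 : 0 <= N by exact: counting_function_ge0.
have : 0 <= N' by exact: counting_function_ge0.
have e1 : (a - 1) / a = 1 - a^-1 by rewrite mulrBl divff ?gt_eqF// mul1r.
have ai1 : 0 < a^-1 by rewrite invr_gt0.
have aai : a * a^-1 = 1 by rewrite divff// gt_eqF.
(* If [N' = 0] the quotient is 0 by convention, at distance 1 from its limit, which exceeds the
   tolerance. *)
rewrite le_eqVlt => /orP[/eqP<-|N'0].
  rewrite invr0 mulr0 subr0 normr1 e1; lra.
rewrite ler_distlC e1 => /andP[].
rewrite ler_pdivlMr// ler_pdivrMr// => h1 h2; split.
  apply: le_trans h2 _; rewrite ler_pM2r//; nra.
have : a * ((1 - (1 - a^-1)) * N') <= a * N by rewrite ler_pM2l.
by rewrite subKr mulrA aai mul1r.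
Qed.

(** The liminf condition at [h = 2], with an explicit margin and in terms of series (see
    [counting_primitiveE]). The cap [c <= 1] controls the powers of [c] when the condition passes to
    an equivalent sequence. *)
Definition min_series_doubling (R : realType) (lam : nat -> R) : Prop :=
  exists c delta : R, [/\ 0 < c <= 1, 0 < delta & forall x, 0 < x < delta ->
    (1 + c) * limn (series (fun k => Num.min (lam k) x)) <=
    limn (series (fun k => Num.min (lam k) (2 * x)))].

Lemma series_min_gt0 (R : realType) (lam : nat -> R) (x : R) :
  (forall k, 0 < lam k) -> cvgn (series lam) -> 0 < x ->
  0 < limn (series (fun k => Num.min (lam k) x)).
Proof.
move=> lam0 clam x0; have cm := is_cvg_series_min lam0 clam x0.
apply: (@lt_le_trans _ _ (series (fun k => Num.min (lam k) x) 1)).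
  by rewrite seriesEnat /= big_nat1 lt_min lam0.
by apply: ge_series_limn => // k; rewrite le_min !ltW.
Qed.

Lemma limf_einf_doubling (R : realType) (lam : nat -> R) :
  (forall k, 0 < lam k) -> cvgn (series lam) ->
  (1 < limf_einf (fun x : R =>
    (counting_primitive lam (2 * x) / counting_primitive lam x)%:E) 0^'+)%E ->
  min_series_doubling lam.
Proof.
move=> lam0 clam; rewrite limf_einfE => /ereal_sup_gt[_ [V FV <-]] inf1.
(* The cap at 2 yields [c = q - 1 <= 1] and covers an infinite infimum. *)
have [q /andP[q1 q2] qV] : exists2 q : R, 1 < q <= 2 & forall x, V x ->
    q <= counting_primitive lam (2 * x) / counting_primitive lam x.
  move: inf1; set i := ereal_inf _ => inf1.
  have Vi x : V x -> (i <= (counting_primitive lam (2 * x) / counting_primitive lam x)%:E)%E.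
    by move=> Vx; apply: ereal_inf_lbound; exists x.
  case: i inf1 Vi => [q||] //= q1 Vi.
    exists (Num.min q 2).
      by rewrite lt_min -lte_fin q1 ltr1n ge_min lexx orbT.
    by move=> x /Vi; rewrite lee_fin; apply: le_trans; rewrite ge_min lexx.
  by exists 2; rewrite ?ltr1n ?lexx// => x /Vi; rewrite leye_eq.
have /at_right0P[delta delta0 Hd] := FV.
exists (q - 1), delta; split => //; first by apply/andP; split; lra.
move=> x xd; have /andP[x0 _] := xd.
have := qV _ (Hd _ xd); have x20 : 0 < 2 * x by rewrite mulr_gt0.
rewrite !counting_primitiveE// ler_pdivlMr; last exact: series_min_gt0.
by rewrite subrKC.
Qed.

(** The comparisons at [x] and at [2 * x] each lose a factor [1 + c / 4], and
    [(1 + c / 4)^2 * (1 + c / 8) <= 1 + c]. *)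
Lemma min_series_doubling_equiv (R : realType) (lam lam' : nat -> R) :
  (forall k, 0 < lam k) -> (forall k, 0 < lam' k) ->
  cvgn (series lam) -> cvgn (series lam') ->
  ratio_equiv 0^'+ (counting_function lam) (counting_function lam') ->
  min_series_doubling lam -> min_series_doubling lam'.
Proof.
move=> lam0 lam'0 clam clam' equiv [c [delta [/andP[c0 c1] delta0 H]]].
have a1 : 1 < 1 + c / 4 by lra.
have [delta1 delta10 H1] := ratio_equiv_counting equiv a1.
exists (c / 8), (Num.min delta (delta1 / 2)); split.
- by apply/andP; split; lra.
- by rewrite lt_min delta0 divr_gt0.
move=> x /andP[x0]; rewrite lt_min => /andP[xd xd1].
have x20 : 0 < 2 * x by rewrite mulr_gt0.
have Hx := H x; rewrite x0 xd in Hx; have {}Hx := Hx isT.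
have a0 : 0 <= 1 + c / 4 by lra.
have h1 : limn (series (fun k => Num.min (lam' k) x)) <=
    (1 + c / 4) * limn (series (fun k => Num.min (lam k) x)).
  apply: (@series_min_comparison _ _ _ _ delta1) => //.
    by rewrite x0 /=; lra.
  by move=> z /H1[].
have h2 : limn (series (fun k => Num.min (lam k) (2 * x))) <=
    (1 + c / 4) * limn (series (fun k => Num.min (lam' k) (2 * x))).
  apply: (@series_min_comparison _ _ _ _ delta1) => //.
    by rewrite x20 /=; lra.
  by move=> z /H1[].
have M0 := series_min_gt0 lam0 clam x0.
have M'0 := series_min_gt0 lam'0 clam' x0.
move: Hx h1 h2 M0 M'0.
set m := limn _; set m2 := limn _; set m' := limn _; set m2' := limn _.
move=> Hx h1 h2 M0 M'0.
rewrite -(@ler_pM2l _ (1 + c / 4)); last by lra.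
apply: le_trans h2; apply: le_trans Hx.
have : (1 + c / 4) * (1 + c / 8) * m' <=
    (1 + c / 4) * (1 + c / 8) * ((1 + c / 4) * m).
  by rewrite ler_wpM2l// mulr_ge0//; lra.
have : (1 + c / 4) * (1 + c / 8) * (1 + c / 4) <= 1 + c.
  have : c * c <= c by nra.
  have : c * (c * c) <= c by nra.
  lra.
move=> h3; have := ler_wpM2r (ltW M0) h3; lra.
Qed.

Lemma log_small_ball_equiv_le (R : realType) d (T : measurableType d)
    (P : probability T R) (X : nat -> {RV P >-> R}) (lam lam' : nat -> R) :
  mutually_independent X -> (forall n, standard_normal (X n)) ->
  (forall k, 0 < lam k) -> (forall k, 0 < lam' k) ->
  cvgn (series lam) -> cvgn (series lam') ->
  min_series_doubling lam' ->
  (forall a, 1 < a -> exists2 delta : R, 0 < delta & forall x, 0 < x < delta ->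
    counting_function lam' x <= a * counting_function lam x) ->
  forall e, 0 < e <= 1 -> exists2 rho, 0 < rho & forall r, 0 < r < rho ->
    0 < - ln (small_ball_probability X lam r) /\
    - ln (small_ball_probability X lam' r) <=
    (1 + e) * - ln (small_ball_probability X lam r).
Proof.
move=> indep normal lam0 lam'0 clam clam' [c [delta [/andP[c0 _] delta0 H]]] comp.
have [U U0 HU] := log_laplace_deficit lam'0 clam' c0 delta0 H.
apply: (log_small_ball_comparison indep normal lam0 clam lam'0 clam' _ U0 HU).
  by rewrite divr_gt0.
move=> a a1; have [delta' delta'0 H'] := comp a a1.
have a0 : 0 <= a by lra.
exact: (log_laplace_comparison lam'0 lam0 clam' clam a0 delta'0 H').
Qed.

Theorem theorem1 (R : realType) (d : measure_display) (T : measurableType d)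
    (P : probability T R) (xi : nat -> {RV P >-> R})
    (xi_indep : mutually_independent xi)
    (xi_normal : forall n, standard_normal (xi n))
    (lam lam' : nat -> R)
    (lam_gt0 : forall n, 0 < lam n) (lam'_gt0 : forall n, 0 < lam' n)
    (lam_summable : cvgn (series lam)) (lam'_summable : cvgn (series lam'))
    (lam_liminf : forall h : R, 1 < h ->
      (1 < limf_einf (fun x : R =>
        (counting_primitive lam (h * x) / counting_primitive lam x)%:E) 0^'+)%E)
    (lam_equiv : ratio_equiv 0^'+ (counting_function lam) (counting_function lam')) :
  ratio_equiv 0^'+
    (fun r => ln (small_ball_probability xi lam' r))
    (fun r => ln (small_ball_probability xi lam r)).
Proof.
have doubling := limf_einf_doubling lam_gt0 lam_summable (lam_liminf _ (ltr1n R 2)).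
have doubling' := min_series_doubling_equiv lam_gt0 lam'_gt0 lam_summable
  lam'_summable lam_equiv doubling.
(* The one-sided estimate is applied both ways, each time with the doubling condition of the
   sequence used for tilting. *)
have le1 := log_small_ball_equiv_le xi_indep xi_normal lam_gt0 lam'_gt0
  lam_summable lam'_summable doubling'.
have le2 := log_small_ball_equiv_le xi_indep xi_normal lam'_gt0 lam_gt0
  lam'_summable lam_summable doubling.
apply/cvgrPdist_le => e0 e00; pose e := Num.min e0 1.
have e01 : 0 < e <= 1 by rewrite lt_min e00 ltr01 ge_min lexx orbT.
have ee0 : e <= e0 by rewrite ge_min lexx.
have [rho1 rho10 H1] := le1 (fun a a1 =>
  let: ex_intro2 delta delta0 H := ratio_equiv_counting lam_equiv a1 in
  ex_intro2 _ _ delta delta0 (fun x xd => (H x xd).2)) e e01.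
have [rho2 rho20 H2] := le2 (fun a a1 =>
  let: ex_intro2 delta delta0 H := ratio_equiv_counting lam_equiv a1 in
  ex_intro2 _ _ delta delta0 (fun x xd => (H x xd).1)) e e01.
apply/at_right0P; exists (Num.min rho1 rho2); first by rewrite lt_min rho10.
move=> r /andP[r0]; rewrite lt_min => /andP[r1 r2].
have [A0 A'A] := H1 r (introT andP (conj r0 r1)).
have [A'0 AA'] := H2 r (introT andP (conj r0 r2)).
rewrite -[ln (small_ball_probability xi lam' r)]opprK.
rewrite -[ln (small_ball_probability xi lam r)]opprK invrN mulrNN.
move: A0 A'A A'0 AA'; set A := - ln _; set A' := - ln _.
move=> A0 A'A A'0 AA'; apply: le_trans ee0.
have /andP[e_gt0 e_le1] := e01.
(* Lower half: [A <= (1 + e) * A'] gives [(1 - e) * A <= (1 - e * e) * A' <= A']. *)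
rewrite ler_distlC ler_pdivlMr// ler_pdivrMr//; apply/andP; split.
  have : (1 - e) * A <= (1 - e) * ((1 + e) * A') by rewrite ler_wpM2l// subr_ge0.
  have : 0 <= e * e * A' by rewrite !mulr_ge0 // ltW.
  lra.
exact: A'A.
Qed.
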